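(* Let $n=3$ or $n=4$. Each symmetric generalized Riemann derivative of order $n$ without excess is a symmetric Gaussian Riemann derivative.
   Context: An $n$-th generalized Riemann difference is $\Delta_{\mathcal{A}}(x,h;f)=\sum_{k=0}^{\ell}A_kf(x+a_kh)$, where the real numbers $A_k$ are non-zero, the real numbers $a_k$ are distinct, and $\sum_{k=0}^{\ell}A_ka_k^j=\delta_{j,n}\cdot n!$ for $j=0,1,\ldots ,n$ (with $0^0=1$). The points $x+a_kh$ are its base points. The associated $n$-th generalized Riemann derivative (of order $n$) is $D_{\mathcal{A}}f(x)=\lim_{h\to 0}\Delta_{\mathcal{A}}(x,h;f)/h^n$. It is without excess if $\ell=n$ (exactly $n+1$ base points), in which case the $a_k$ determine the $A_k$. It is symmetric if $\Delta_{\mathcal{A}}(x,-h;f)=(-1)^n\Delta_{\mathcal{A}}(x,h;f)$; for a difference without excess this is equivalent to the set $\{a_0,\ldots ,a_n\}$ being symmetric with respect to the origin. The scale by a real $r\neq 0$ of the difference with data $\{A_k;a_k\}$ is the $n$-th generalized Riemann difference with data $\{r^{-n}A_k;ra_k\}$; a difference and its scales define the same derivative, and derivatives are identified accordingly. A symmetric Gaussian Riemann derivative of order $n$ is one which, up to a scale, is for some real $q\neq 0,\pm1$ the $n$-th generalized Riemann derivative without excess ${_q}D_n^s$ based at $x\pm h,x\pm qh,\ldots ,x\pm q^{m-1}h$, together with $x$ when $n$ is even, where $m=\lfloor (n+1)/2\rfloor$. *)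

(* Defs.v *)
From mathcomp Require Import all_boot all_order all_algebra.
From mathcomp Require Import all_classical all_reals all_analysis.
Set Implicit Arguments.
Unset Strict Implicit.
Unset Printing Implicit Defensive.
Import Order.TTheory GRing.Theory Num.Theory.
Import numFieldNormedType.Exports.
Local Open Scope classical_set_scope.
Local Open Scope ring_scope.

Record riemann_data (R : realType) := RiemannData {
  ell : nat;
  coef : 'I_ell.+1 -> R;
  node : 'I_ell.+1 -> R
}.
Arguments coef {R} d k : rename.
Arguments node {R} d k : rename.

Definition difference (R : realType) (d : riemann_data R) (x h : R)
    (f : R -> R) : R :=
  \sum_(k < (ell d).+1) coef d k * f (x + node d k * h).

Definition is_riemann_difference (R : realType) (n : nat)
    (d : riemann_data R) : Prop :=
  [/\ forall k, coef d k != 0,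
      injective (node d) &
      forall j : nat, (j <= n)%N ->
        \sum_(k < (ell d).+1) coef d k * node d k ^+ j
          = (j == n)%:R * n`!%:R].

(* As a partial operator: the derivative of f at x exists and equals l. *)
Definition riemann_derivative (R : realType) (n : nat) (d : riemann_data R)
    (f : R -> R) (x l : R) : Prop :=
  difference d x h f / h ^+ n @[h --> (0 : R)^'] --> l.

Definition without_excess (R : realType) (n : nat) (d : riemann_data R) :
  Prop := ell d = n.

Definition symmetric_difference (R : realType) (n : nat)
    (d : riemann_data R) : Prop :=
  forall (x h : R) (f : R -> R),
    difference d x (- h) f = (-1) ^+ n * difference d x h f.

(* Meant for r != 0, see [scale_is_riemann_difference]. *)
Definition scale (R : realType) (n : nat) (r : R) (d : riemann_data R) :
    riemann_data R :=
  {| ell := ell d;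
     coef := fun k => r ^- n * coef d k;
     node := fun k => r * node d k |}.

(* Derivatives are identified when their differences agree up to a scale.
   Differences are compared as operators, so that the numbering of the base
   points is irrelevant; see [same_derivativeP] for the limits. *)
Definition same_derivative (R : realType) (n : nat) (d e : riemann_data R) :
    Prop :=
  exists r : R, r != 0 /\
    forall (x h : R) (f : R -> R),
      difference d x h f = difference (scale n r e) x h f.

(* Relative base points +-1, +-q, .., +-q^(m-1) with m = floor((n+1)/2),
   and 0 when n is even. *)
Definition gaussian_difference (R : realType) (n : nat) (q : R)
    (d : riemann_data R) : Prop :=
  [/\ is_riemann_difference n d,
      without_excess n d &
      range (node d) =
        [set a | exists2 i : nat, (i < n.+1./2)%N & a = q ^+ i \/ a = - q ^+ i]
        `|` [set a | ~~ odd n /\ a = 0]].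

Definition symmetric_gaussian_derivative (R : realType) (n : nat)
    (d : riemann_data R) : Prop :=
  exists (q : R) (e : riemann_data R),
    [/\ q != 0, q != 1, q != -1, gaussian_difference n q e &
        same_derivative n d e].

Lemma difference_scale (R : realType) n (r : R) d x h f :
  difference (scale n r d) x h f = r ^- n * difference d x (r * h) f.
Proof.
rewrite /difference mulr_sumr; apply: eq_bigr => k _ /=.
by rewrite -!mulrA; congr (_ * (_ * f (_ + _))); rewrite mulrCA.
Qed.

Lemma scale_is_riemann_difference (R : realType) n (r : R) d :
  r != 0 -> is_riemann_difference n d -> is_riemann_difference n (scale n r d).
Proof.
move=> r0 [cn ni mom]; split=> /=.
- by move=> k; rewrite mulf_neq0 ?invr_eq0 ?expf_neq0.
- by move=> i j /(mulfI r0) /ni.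
- move=> j jn; under eq_bigr => k _ do rewrite exprMn mulrACA.
  rewrite -mulr_sumr mom//; case: eqP => [->|_]; last by rewrite !mul0r mulr0.
  by rewrite mulVf ?expf_neq0// mul1r.
Qed.

Lemma riemann_derivative_scale (R : realType) n (r : R) d f x l :
  r != 0 -> riemann_derivative n d f x l ->
  riemann_derivative n (scale n r d) f x l.
Proof.
rewrite /riemann_derivative => r0 /cvgr_dnbhsP dl.
apply/cvgr_dnbhsP => u [u0 ul].
have -> : (fun k => difference (scale n r d) x (u k) f / u k ^+ n) =
    (fun k => difference d x (r * u k) f / (r * u k) ^+ n).
  apply/funext => k; rewrite difference_scale exprMn invfM.
  by rewrite [RHS]mulrA; congr (_ * _); exact: mulrC.
apply: (dl (fun k => r * u k)); split; first by move=> k; rewrite mulf_neq0.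
by rewrite -[X in _ --> X](mulr0 r); exact: cvgMl_tmp.
Qed.

Lemma same_derivativeP (R : realType) n (d e : riemann_data R) :
  same_derivative n d e ->
  forall f x l, riemann_derivative n d f x l <-> riemann_derivative n e f x l.
Proof.
move=> [r [r0 de]] f x l.
have dE : riemann_derivative n d f x l <->
    riemann_derivative n (scale n r e) f x l.
  by rewrite /riemann_derivative; under eq_fun do rewrite de.
have eE : riemann_derivative n (scale n r^-1 (scale n r e)) f x l <->
    riemann_derivative n e f x l.
  rewrite /riemann_derivative; under eq_fun => h.
    rewrite 2!difference_scale mulVKf// mulrA -invfM -exprMn mulVf//.
    by rewrite expr1n invr1 mul1r; over.
  by [].
rewrite dE; split; last exact: riemann_derivative_scale.
by move=> ?; apply/eE/riemann_derivative_scale => //; rewrite invr_eq0.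
Qed.

(* Main.v *)
(** Testing the symmetry on the indicator function of a point shows that the
set of nodes is symmetric with respect to the origin, and that the origin is
not a node when [n] is odd; by parity of the number [n + 1] of nodes, it is one
when [n] is even.  For [n = 3] or [4] the nonzero nodes are thus [a, -a, b, -b]
with [0 < a], [0 < b], [a != b], and scaling by [1 / a] gives the Gaussian
nodes for [q = b / a]. *)
Require Import Defs.
From mathcomp Require Import all_boot all_order all_algebra.
From mathcomp Require Import all_classical all_reals all_analysis.

Module SymmetricNodes.
Import Order.TTheory GRing.Theory Num.Theory.
Local Open Scope classical_set_scope.
Local Open Scope ring_scope.

(** Negation exchanges the positive and the negative elements, and there are no others. This serves
    for counting: the size of [s] is twice its number of positive elements. *)
Lemma perm_pos_opp (R : realDomainType) (s : seq R) :
  uniq s -> 0 \notin s -> {in s, forall x, - x \in s} ->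
  perm_eq s ([seq x <- s | 0 < x] ++ map -%R [seq x <- s | 0 < x]).
Proof.
move=> us s0 sN; apply: uniq_perm => //.
  rewrite cat_uniq (map_inj_uniq oppr_inj) !filter_uniq// andbT.
  apply/hasPn => _ /mapP[x + ->]; rewrite mem_filter => /andP[x0 _].
  by rewrite mem_filter oppr_gt0 lt_gtF.
move=> x; rewrite mem_cat -{3}[x]opprK (mem_map oppr_inj) !mem_filter oppr_gt0.
have -> : (- x \in s) = (x \in s).
  by apply/idP/idP => /sN //; rewrite opprK.
rewrite -andb_orl; case: (boolP (x \in s)) => [xs|]; last by rewrite andbF.
by rewrite andbT orbC -neq_lt; apply/esym; apply: contraNneq s0 => <-.
Qed.

(** For [x = 0] and [h = 1] the base points are the nodes themselves, so the indicator of one node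
    isolates its coefficient. *)
Lemma difference_indic (R : realType) (d : riemann_data R) i :
  injective (node d) ->
  difference d 0 1 (fun y => (y == node d i)%:R) = coef d i.
Proof.
move=> inj; rewrite /difference (bigD1 i)//= mulr1 add0r eqxx mulr1.
rewrite big1 ?addr0// => k ki.
by rewrite mulr1 add0r (inj_eq inj) (negPf ki) mulr0.
Qed.

Section symmetric.
Variables (R : realType) (n : nat) (d : riemann_data R).
Hypotheses (hd : is_riemann_difference n d) (hsym : symmetric_difference n d).

Lemma node_opp x : x \in codom (node d) -> - x \in codom (node d).
Proof.
have [c0 inj _] := hd => /codomP[i ->]; apply: contraTT (c0 i) => Ni.
(* If [- node d i] is not a node, the side with [h = -1] vanishes, while the other one is [coef d i]
   up to sign. *)
have := hsym 0 1 (fun y => (y == node d i)%:R).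
rewrite difference_indic// /difference big1 => [/esym/eqP|k _].
  by rewrite mulf_eq0 signr_eq0 negbK.
rewrite add0r mulrN1 eqr_oppLR; case: eqP => [ki|_]; last by rewrite mulr0.
by rewrite -ki codom_f in Ni.
Qed.

(** The indicator of 0 is an even function, so [h] and [- h] give the same difference; for odd [n]
    symmetry makes them opposite, hence the coefficient at 0 would vanish. *)
Lemma node_neq0_odd : odd n -> 0 \notin codom (node d).
Proof.
have [c0 inj _] := hd => on; apply/codomP => -[i /esym i0].
have := hsym 0 1 (fun y => (y == node d i)%:R).
have -> : difference d 0 (- 1) (fun y => (y == node d i)%:R) =
    difference d 0 1 (fun y => (y == node d i)%:R).
  rewrite /difference; apply: eq_bigr => k _.
  by rewrite i0 !add0r mulrN1 mulr1 oppr_eq0.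
rewrite difference_indic// -signr_odd on expr1 mulN1r => /eqP.
by rewrite -addr_eq0 -mulr2n mulrn_eq0/= (negPf (c0 i)).
Qed.

(** The boolean [~~ odd n] counts as 0 or 1, so that [nseq] adds the node 0 exactly when [n] is
    even. *)
Lemma nodes_symmetric : without_excess n d ->
  exists p : seq R, [/\ size p = n.+1./2, uniq p, all (> 0) p &
    codom (node d) =i p ++ map -%R p ++ nseq (~~ odd n) 0].
Proof.
have [_ inj _] := hd => en.
have us : uniq (codom (node d)) by rewrite map_inj_uniq// enum_uniq.
have ss : size (codom (node d)) = n.+1 by rewrite size_codom card_ord en.
have [s0|s0] := boolP (0 \in codom (node d)).
- have on : ~~ odd n by apply: contraL s0; exact: node_neq0_odd.
  pose t := rem 0 (codom (node d)).
  have tE x : (x \in t) = (x != 0) && (x \in codom (node d)).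
    by rewrite /t mem_rem_uniq.
  have pt : perm_eq t ([seq x <- t | 0 < x] ++ map -%R [seq x <- t | 0 < x]).
    apply: perm_pos_opp; rewrite ?rem_uniq// ?tE ?eqxx// => x.
    by rewrite !tE oppr_eq0 => /andP[-> /node_opp].
  exists [seq x <- t | 0 < x]; split.
  (* Removing 0 leaves [n] nodes, half of them positive. *)
  + have /eqP := perm_size pt; rewrite size_rem// ss size_cat size_map/= addnn.
    by move=> /eqP ->; rewrite uphalf_double.
  + by rewrite filter_uniq// rem_uniq.
  + exact: filter_all.
  + move=> x; rewrite on catA mem_cat -(perm_mem pt) tE mem_seq1.
    by case: eqVneq => [->|]; rewrite ?orbT ?orbF.
- have := perm_pos_opp _ _ us s0 node_opp.
  set p := [seq x <- _ | 0 < x] => pt.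
  have := perm_size pt; rewrite ss size_cat size_map addnn => np.
  exists p; split.
  + by rewrite np doubleK.
  + by rewrite filter_uniq.
  + exact: filter_all.
  (* The [n.+1] nodes split into opposite pairs, so [n.+1] is even. *)
  + have -> : odd n by rewrite -[odd n]negbK -oddS np odd_double.
    by move=> x; rewrite cats0 (perm_mem pt).
Qed.

End symmetric.

Lemma same_derivative_scaleV (R : realType) n (r : R) (d : riemann_data R) :
  r != 0 -> same_derivative n d (scale n r^-1 d).
Proof.
move=> r0; exists r; split=> // x h f.
rewrite !difference_scale mulKf// exprVn invrK mulrA mulVf ?mul1r//.
by rewrite expf_neq0.
Qed.

(** The condition [n.+1./2 = 2] treats orders 3 and 4 together: they differ only by the node 0. *)
Lemma gaussian_of_nodes (R : realType) n (d : riemann_data R) (a b : R) :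
  is_riemann_difference n d -> without_excess n d -> n.+1./2 = 2%N ->
  0 < a -> 0 < b -> a != b ->
  codom (node d) =i [:: a, b, - a, - b & nseq (~~ odd n) 0] ->
  symmetric_gaussian_derivative n d.
Proof.
move=> hd en n2 a0 b0 ab dE.
have an0 : a != 0 by rewrite gt_eqF.
exists (b / a), (scale n a^-1 d); split.
- by rewrite mulf_neq0 ?invr_eq0// gt_eqF.
(* Here [q - 1] is [(b - a) / a]. *)
- by rewrite -subr_eq0 -(divff an0) -mulrBl mulf_neq0 ?invr_eq0// subr_eq0 eq_sym.
- by rewrite gt_eqF// (lt_trans (ltrN10 _)) ?divr_gt0.
- split=> //; first by apply: scale_is_riemann_difference; rewrite ?invr_eq0.
  have nodeE y : range (node (scale n a^-1 d)) y <->
      a * y \in [:: a, b, - a, - b & nseq (~~ odd n) 0].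
    rewrite -dE; split=> [[k _ <-]|/codomP[k yk]]; first by rewrite mulVKf ?codom_f.
    by exists k => //=; rewrite -yk mulKf.
  have qE y : (a * y == b) = (y == b / a).
    by rewrite -(inj_eq (mulfI an0) y) mulrCA divff ?mulr1.
  have oneE y : (a * y == a) = (y == 1).
    by rewrite -{2}[a]mulr1 (inj_eq (mulfI an0)).
  have zeroE y : (a * y == 0) = (y == 0) by rewrite mulf_eq0 (negPf an0).
  apply/seteqP; split=> y.
    move=> /nodeE; rewrite !inE -!eqr_oppLR -!mulrN !oneE !qE mem_nseq zeroE.
    rewrite !eqr_oppLR => /or4P[/eqP->|/eqP->|/eqP->|/orP[/eqP->|/andP[]]].
    + by left; exists 0%N; rewrite ?n2//; left.
    + by left; exists 1%N; rewrite ?n2//; left.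
    + by left; exists 0%N; rewrite ?n2//; right.
    + by left; exists 1%N; rewrite ?n2//; right.
    + by rewrite lt0b => on /eqP->; right.
  move=> yq; apply/nodeE; move: yq.
  rewrite !inE -!eqr_oppLR -!mulrN !oneE !qE mem_nseq zeroE !eqr_oppLR.
  (* Only the exponents 0 and 1 are below 2; they give the nodes [a], [- a] and [b], [- b] of
     [d]. *)
  case=> [[[|[|i]]]|[on ->]]; rewrite ?n2//.
  + by rewrite expr0 => _ [] ->; rewrite eqxx ?orbT.
  + by rewrite expr1 => _ [] ->; rewrite eqxx ?orbT.
  + by rewrite on eqxx !orbT.
- exact: same_derivative_scaleV.
Qed.

End SymmetricNodes.

Theorem proposition2p4 (R : realType) (n : nat) (hn : n = 3 \/ n = 4)
    (d : riemann_data R) (hd : is_riemann_difference n d)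
    (hexcess : without_excess n d) (hsym : symmetric_difference n d) :
  symmetric_gaussian_derivative n d.
Proof.
have n2 : n.+1./2 = 2 by case: hn => ->.
have [p [sp up pp dE]] := SymmetricNodes.nodes_symmetric R n d hd hsym hexcess.
move: sp up pp dE; rewrite n2; case: p => [|a [|b []]]//= _.
rewrite mem_seq1 !andbT => ab /andP[a0 b0].
exact: SymmetricNodes.gaussian_of_nodes.
Qed.
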